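(* Let $V$ be a finite-dimensional vector space. For every $k\ge1$, the dimension of the $k$-th graded component of the free $\mathrm{As}^2$-algebra generated by $V$ is equal to $c_k(\dim V)^k$, where $c_k=\frac1{k+1}\binom{2k}{k}$ is the $k$-th Catalan number. In particular, the dimension of the $k$-th graded component of the free $\mathrm{As}^2$-algebra with one generator is equal to the $k$-th Catalan number $c_k$.
   Context: Work over a field of characteristic zero. An $\mathrm{As}^2$-algebra (algebra with two compatible associative products) is a (not necessarily unital) vector space with two bilinear operations $\star_1,\star_2$ such that each is associative, $(a\star_i b)\star_i c=a\star_i(b\star_i c)$ for $i=1,2$, and $$(a\star_1 b)\star_2 c+(a\star_2 b)\star_1 c=a\star_1 (b\star_2 c)+a\star_2 (b\star_1 c).$$ The free $\mathrm{As}^2$-algebra generated by $V$ is graded by declaring elements of $V$ to have degree $1$ and both products to be of degree $0$; its $k$-th component is spanned by all products of $k$ elements of $V$. There is no unit, so degrees start at $1$. *)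

(* Defs.v *)
From HB Require Import structures.
From mathcomp Require Import all_boot all_order all_algebra.
From mathcomp Require Import boolp.

Set Implicit Arguments.
Unset Strict Implicit.
Unset Printing Implicit Defensive.

Import GRing.Theory.
Local Open Scope ring_scope.
Local Open Scope quotient_scope.

(* Algebras with two compatible associative products; no unit is assumed, in
   particular the zero space is allowed. *)
HB.mixin Record Lmodule_isAs2Algebra (F : fieldType) A
    of GRing.Lmodule F A := {
  star1 : A -> A -> A;
  star2 : A -> A -> A;
  star1_bilinear : bilinear_for *:%R *:%R star1;
  star2_bilinear : bilinear_for *:%R *:%R star2;
  star1A : forall a b c : A, star1 (star1 a b) c = star1 a (star1 b c);
  star2A : forall a b c : A, star2 (star2 a b) c = star2 a (star2 b c);
  star_compat : forall a b c : A,
    star2 (star1 a b) c + star1 (star2 a b) c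
    = star1 a (star2 b c) + star2 a (star1 b c)
}.

#[short(type="as2AlgType")]
HB.structure Definition As2Algebra (F : fieldType) :=
  {A of GRing.Lmodule F A & Lmodule_isAs2Algebra F A}.

Notation "a '⋆1' b" := (star1 a b) (at level 40, left associativity).
Notation "a '⋆2' b" := (star2 a b) (at level 40, left associativity).

Definition as2_morphism (F : fieldType) (A B : as2AlgType F) (f : A -> B) :=
  [/\ linear f,
      {morph f : a b / a ⋆1 b >-> a ⋆1 b}
    & {morph f : a b / a ⋆2 b >-> a ⋆2 b}].

Definition is_free_as2 (F : fieldType) (V : lmodType F) (A : as2AlgType F)
    (i : {linear V -> A}) : Prop :=
  forall (B : as2AlgType F) (g : {linear V -> B}),
    (exists2 f : A -> B, as2_morphism f & forall v, f (i v) = g v) /\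
    (forall f f' : A -> B, as2_morphism f -> as2_morphism f' ->
       (forall v, f (i v) = g v) -> (forall v, f' (i v) = g v) -> f =1 f').

(* Products of exactly k generators, with any bracketing and any choice of the
   operations; k >= 1 automatically. *)
Inductive as2_product (F : fieldType) (V : lmodType F) (A : as2AlgType F)
    (i : V -> A) : nat -> A -> Prop :=
| Product_gen v : as2_product i 1 (i v)
| Product_star1 m n a b : as2_product i m a -> as2_product i n b ->
    as2_product i (m + n) (a ⋆1 b)
| Product_star2 m n a b : as2_product i m a -> as2_product i n b ->
    as2_product i (m + n) (a ⋆2 b).

(* The spaces in play need not be finite-dimensional, so subspaces are
   Prop-valued predicates rather than {vspace _}. *)
Definition lin_span (F : fieldType) (A : lmodType F) (S : A -> Prop) (x : A) :=
  exists (n : nat) (c : 'I_n -> F) (s : 'I_n -> A),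
    (forall j, S (s j)) /\ x = \sum_j c j *: s j.

Definition graded_component (F : fieldType) (V : lmodType F)
    (A : as2AlgType F) (i : V -> A) (k : nat) : A -> Prop :=
  lin_span (as2_product i k).

(* The subspace S has a basis with n elements. *)
Definition has_dim (F : fieldType) (A : lmodType F) (S : A -> Prop) (n : nat) :=
  exists b : 'I_n -> A,
    (forall c : 'I_n -> F, \sum_j c j *: b j = 0 -> forall j, c j = 0) /\
    (forall x, S x <-> exists c : 'I_n -> F, x = \sum_j c j *: b j).

Definition catalan (k : nat) : nat := ('C(2 * k, k) %/ k.+1)%N.

(* The division in [catalan] is exact. *)
Lemma catalanE (k : nat) : (k.+1 * catalan k = 'C(2 * k, k))%N.
Proof.
rewrite /catalan mulnC divnK //.
have E : (k.+1 * 'C(2 * k, k.+1) = k * 'C(2 * k, k))%N.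
  by rewrite mul_bin_left mul2n -addnn addnK.
have -> : 'C(2 * k, k) = ((k.+1 * 'C(2 * k, k)) - k.+1 * 'C(2 * k, k.+1))%N.
  by rewrite E mulSn addnK.
by rewrite -mulnBr dvdn_mulr.
Qed.

(* Free algebras exist: terms modulo the congruence generated by the axioms. *)
Module FreeAs2.
Section Existence.
Variables (F : fieldType) (V : lmodType F).

Inductive term :=
| Gen of V | Zero | Opp of term | Add of term & term | Scale of F & term
| Star1 of term & term | Star2 of term & term.

Inductive cong : term -> term -> Prop :=
| cong_refl x : cong x x
| cong_sym x y : cong x y -> cong y x
| cong_trans x y z : cong x y -> cong y z -> cong x z
| cong_opp x x' : cong x x' -> cong (Opp x) (Opp x')
| cong_add x x' y y' : cong x x' -> cong y y' -> cong (Add x y) (Add x' y')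
| cong_scale k x x' : cong x x' -> cong (Scale k x) (Scale k x')
| cong_star1 x x' y y' :
    cong x x' -> cong y y' -> cong (Star1 x y) (Star1 x' y')
| cong_star2 x x' y y' :
    cong x x' -> cong y y' -> cong (Star2 x y) (Star2 x' y')
| ax_addA x y z : cong (Add x (Add y z)) (Add (Add x y) z)
| ax_addC x y : cong (Add x y) (Add y x)
| ax_add0 x : cong (Add Zero x) x
| ax_addN x : cong (Add (Opp x) x) Zero
| ax_scaleA k l x : cong (Scale k (Scale l x)) (Scale (k * l) x)
| ax_scale1 x : cong (Scale 1 x) x
| ax_scaleDr k x y : cong (Scale k (Add x y)) (Add (Scale k x) (Scale k y))
| ax_scaleDl x k l : cong (Scale (k + l) x) (Add (Scale k x) (Scale l x))
| ax_gen k u v : cong (Gen (k *: u + v)) (Add (Scale k (Gen u)) (Gen v))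
| ax_star1l z k x y : cong (Star1 (Add (Scale k x) y) z)
                           (Add (Scale k (Star1 x z)) (Star1 y z))
| ax_star1r z k x y : cong (Star1 z (Add (Scale k x) y))
                           (Add (Scale k (Star1 z x)) (Star1 z y))
| ax_star2l z k x y : cong (Star2 (Add (Scale k x) y) z)
                           (Add (Scale k (Star2 x z)) (Star2 y z))
| ax_star2r z k x y : cong (Star2 z (Add (Scale k x) y))
                           (Add (Scale k (Star2 z x)) (Star2 z y))
| ax_star1A x y z : cong (Star1 (Star1 x y) z) (Star1 x (Star1 y z))
| ax_star2A x y z : cong (Star2 (Star2 x y) z) (Star2 x (Star2 y z))
| ax_compat x y z :
    cong (Add (Star2 (Star1 x y) z) (Star1 (Star2 x y) z))
         (Add (Star1 x (Star2 y z)) (Star2 x (Star1 y z))).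

Definition congb (x y : {classic term}) : bool := `[< cong x y >].

Fact congb_refl : reflexive congb.
Proof. by move=> x; apply/asboolP/cong_refl. Qed.

Fact congb_sym : symmetric congb.
Proof. by move=> x y; apply/asboolP/asboolP; apply: cong_sym. Qed.

Fact congb_trans : transitive congb.
Proof.
by move=> y x z /asboolP xy /asboolP yz; apply/asboolP/(cong_trans xy yz).
Qed.

Canonical congb_equiv := EquivRel congb congb_refl congb_sym congb_trans.

Definition free_as2 := {eq_quot congb}.
HB.instance Definition _ := Choice.on free_as2.

Definition proj (x : term) : free_as2 := \pi_{eq_quot congb} x.
Definition lift (a : free_as2) : term := repr (a : {eq_quot congb}).

Lemma projP x y : proj x = proj y <-> cong x y.
Proof.
split=> [/eqquotP/asboolP //|xy]; apply/eqquotP; exact/asboolP.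
Qed.

Lemma projK a : proj (lift a) = a. Proof. exact: reprK. Qed.

Lemma lift_proj x : cong (lift (proj x)) x.
Proof. by apply/projP; rewrite projK. Qed.

Lemma free_ind (P : free_as2 -> Prop) : (forall x, P (proj x)) -> forall a, P a.
Proof. by move=> H a; rewrite -(projK a). Qed.

(* The operations are locked so that unification does not unfold them. *)
Fact fkey : unit. Proof. by []. Qed.
Definition fadd a b := locked_with fkey (proj (Add (lift a) (lift b))).
Definition fopp a := locked_with fkey (proj (Opp (lift a))).
Definition fscale k a := locked_with fkey (proj (Scale k (lift a))).
Definition fstar1 a b := locked_with fkey (proj (Star1 (lift a) (lift b))).
Definition fstar2 a b := locked_with fkey (proj (Star2 (lift a) (lift b))).

Lemma faddE x y : fadd (proj x) (proj y) = proj (Add x y).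
Proof. by rewrite /fadd unlock; apply/projP/cong_add; exact: lift_proj. Qed.
Lemma foppE x : fopp (proj x) = proj (Opp x).
Proof. by rewrite /fopp unlock; apply/projP/cong_opp; exact: lift_proj. Qed.
Lemma fscaleE k x : fscale k (proj x) = proj (Scale k x).
Proof. by rewrite /fscale unlock; apply/projP/cong_scale; exact: lift_proj. Qed.
Lemma fstar1E x y : fstar1 (proj x) (proj y) = proj (Star1 x y).
Proof. by rewrite /fstar1 unlock; apply/projP/cong_star1; exact: lift_proj. Qed.
Lemma fstar2E x y : fstar2 (proj x) (proj y) = proj (Star2 x y).
Proof. by rewrite /fstar2 unlock; apply/projP/cong_star2; exact: lift_proj. Qed.

Let projE := (faddE, foppE, fscaleE, fstar1E, fstar2E).

Fact faddA : associative fadd.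
Proof.
elim/free_ind=> x; elim/free_ind=> y; elim/free_ind=> z.
by rewrite !projE; apply/projP/ax_addA.
Qed.

Fact faddC : commutative fadd.
Proof.
by elim/free_ind=> x; elim/free_ind=> y; rewrite !projE; apply/projP/ax_addC.
Qed.

Fact fadd0 : left_id (proj Zero) fadd.
Proof. by elim/free_ind=> x; rewrite !projE; apply/projP/ax_add0. Qed.

Fact faddN : left_inverse (proj Zero) fopp fadd.
Proof. by elim/free_ind=> x; rewrite !projE; apply/projP/ax_addN. Qed.

HB.instance Definition _ :=
  GRing.isZmodule.Build free_as2 faddA faddC fadd0 faddN.

Fact fscaleA k l a : fscale k (fscale l a) = fscale (k * l) a.
Proof. by elim/free_ind: a => x; rewrite !projE; apply/projP/ax_scaleA. Qed.

Fact fscale1 : left_id 1 fscale.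
Proof. by elim/free_ind=> x; rewrite !projE; apply/projP/ax_scale1. Qed.

Fact fscaleDr : right_distributive fscale fadd.
Proof.
move=> k; elim/free_ind=> x; elim/free_ind=> y.
by rewrite !projE; apply/projP/ax_scaleDr.
Qed.

Fact fscaleDl a : {morph fscale^~ a : k l / k + l >-> fadd k l}.
Proof.
by move=> k l; elim/free_ind: a => x; rewrite !projE; apply/projP/ax_scaleDl.
Qed.

HB.instance Definition _ := GRing.Zmodule_isLmodule.Build F free_as2
  fscaleA fscale1 fscaleDr fscaleDl.

Lemma proj_add x y : proj x + proj y = proj (Add x y). Proof. exact: faddE. Qed.
Lemma proj_scale k x : k *: proj x = proj (Scale k x).
Proof. exact: fscaleE. Qed.

Let ringE := (proj_add, proj_scale, fstar1E, fstar2E).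

Fact fstar1_bilinear : bilinear_for *:%R *:%R fstar1.
Proof.
have l c k a b : fstar1 (k *: a + b) c = k *: fstar1 a c + fstar1 b c.
  elim/free_ind: a => x; elim/free_ind: b => y; elim/free_ind: c => z.
  by rewrite !ringE; apply/projP/ax_star1l.
have r c k a b : fstar1 c (k *: a + b) = k *: fstar1 c a + fstar1 c b.
  elim/free_ind: a => x; elim/free_ind: b => y; elim/free_ind: c => z.
  by rewrite !ringE; apply/projP/ax_star1r.
by split=> c k a b; [exact: l | exact: r].
Qed.

Fact fstar2_bilinear : bilinear_for *:%R *:%R fstar2.
Proof.
have l c k a b : fstar2 (k *: a + b) c = k *: fstar2 a c + fstar2 b c.
  elim/free_ind: a => x; elim/free_ind: b => y; elim/free_ind: c => z.
  by rewrite !ringE; apply/projP/ax_star2l.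
have r c k a b : fstar2 c (k *: a + b) = k *: fstar2 c a + fstar2 c b.
  elim/free_ind: a => x; elim/free_ind: b => y; elim/free_ind: c => z.
  by rewrite !ringE; apply/projP/ax_star2r.
by split=> c k a b; [exact: l | exact: r].
Qed.

Fact fstar1A a b c : fstar1 (fstar1 a b) c = fstar1 a (fstar1 b c).
Proof.
elim/free_ind: a => x; elim/free_ind: b => y; elim/free_ind: c => z.
by rewrite !projE; apply/projP/ax_star1A.
Qed.

Fact fstar2A a b c : fstar2 (fstar2 a b) c = fstar2 a (fstar2 b c).
Proof.
elim/free_ind: a => x; elim/free_ind: b => y; elim/free_ind: c => z.
by rewrite !projE; apply/projP/ax_star2A.
Qed.

Fact fstar_compat a b c :
  fstar2 (fstar1 a b) c + fstar1 (fstar2 a b) c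
  = fstar1 a (fstar2 b c) + fstar2 a (fstar1 b c).
Proof.
elim/free_ind: a => x; elim/free_ind: b => y; elim/free_ind: c => z.
by rewrite !ringE; apply/projP/ax_compat.
Qed.

HB.instance Definition _ := Lmodule_isAs2Algebra.Build F free_as2
  fstar1_bilinear fstar2_bilinear fstar1A fstar2A fstar_compat.

Definition fgen (v : V) : free_as2 := proj (Gen v).

Fact fgen_linear : linear fgen.
Proof.
move=> k u v; rewrite /fgen !ringE.
exact/projP/ax_gen.
Qed.

HB.instance Definition _ := GRing.isLinear.Build F V free_as2 *:%R fgen
  fgen_linear.

Fixpoint eval (B : as2AlgType F) (g : V -> B) (x : term) : B :=
  match x with
  | Gen v => g v
  | Zero => 0
  | Opp y => - eval g y
  | Add y z => eval g y + eval g z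
  | Scale k y => k *: eval g y
  | Star1 y z => eval g y ⋆1 eval g z
  | Star2 y z => eval g y ⋆2 eval g z
  end.

Lemma eval_cong (B : as2AlgType F) (g : {linear V -> B}) x y :
  cong x y -> eval g x = eval g y.
Proof.
elim=> {x y} //=.
- by move=> x y z _ -> _ ->.
- by move=> x x' _ ->.
- by move=> x x' y y' _ -> _ ->.
- by move=> k x x' _ ->.
- by move=> x x' y y' _ -> _ ->.
- by move=> x x' y y' _ -> _ ->.
- by move=> *; rewrite addrA.
- by move=> *; rewrite addrC.
- by move=> *; rewrite add0r.
- by move=> *; rewrite addNr.
- by move=> *; rewrite scalerA.
- by move=> *; rewrite scale1r.
- by move=> *; rewrite scalerDr.
- by move=> *; rewrite scalerDl.
- by move=> *; rewrite linearP.
- by move=> z k x y; apply: star1_bilinear.1.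
- by move=> z k x y; apply: star1_bilinear.2.
- by move=> z k x y; apply: star2_bilinear.1.
- by move=> z k x y; apply: star2_bilinear.2.
- by move=> *; apply: star1A.
- by move=> *; apply: star2A.
- by move=> *; apply: star_compat.
Qed.

Lemma free_as2P : is_free_as2 (fgen : {linear V -> free_as2}).
Proof.
move=> B g; split.
  have E x : eval g (lift (proj x)) = eval g x.
    exact/eval_cong/lift_proj.
  exists (fun a => eval g (lift a)); last by move=> v; rewrite E.
  split.
  - move=> k; elim/free_ind=> x; elim/free_ind=> y.
    by rewrite !ringE !E.
  - by elim/free_ind=> x; elim/free_ind=> y; rewrite [_ ⋆1 _]fstar1E !E.
  - by elim/free_ind=> x; elim/free_ind=> y; rewrite [_ ⋆2 _]fstar2E !E.
suff U f : as2_morphism f -> (forall v, f (fgen v) = g v) ->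
    forall x, f (proj x) = eval g x.
  by move=> f f' mf mf' fg fg'; elim/free_ind=> x; rewrite !U.
case=> lf f1 f2 fg.
have fD a b : f (a + b) = f a + f b by rewrite -[a]scale1r lf !scale1r.
have f0 : f 0 = 0 by apply: (addrI (f 0)); rewrite -fD !addr0.
have fZ k a : f (k *: a) = k *: f a by rewrite -[k *: a]addr0 lf f0 addr0.
elim=> //= [x <-|x <- y <-|k x <-|x <- y <-|x <- y <-].
- by rewrite -foppE -scaleN1r -fZ scaleN1r.
- by rewrite -proj_add fD.
- by rewrite -proj_scale fZ.
- by rewrite -f1; congr f; rewrite [RHS]fstar1E.
- by rewrite -f2; congr f; rewrite [RHS]fstar2E.
Qed.

End Existence.

Theorem free_as2_exists (F : fieldType) (V : lmodType F) :
  exists (A : as2AlgType F) (i : {linear V -> A}), is_free_as2 i.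
Proof. by exists (free_as2 V), (@fgen F V); exact: free_as2P. Qed.

End FreeAs2.

(* Main.v *)
Require Import Defs.
From HB Require Import structures.
From mathcomp Require Import all_boot all_order all_algebra.
From mathcomp Require Import boolp finmap zify.
From mathcomp.multinomials Require Import monalg.

Set Implicit Arguments.
Unset Strict Implicit.
Unset Printing Implicit Defensive.

Import GRing.Theory.

(** Normal forms suggest the shape of the free algebra.  Adjoin one element 1
that is a unit for both products.  Associativity of each product and the
compatibility relation, read from left to right as
  (p ⋆2 q) ⋆1 m = p ⋆1 (q ⋆2 m) + p ⋆2 (q ⋆1 m) - (p ⋆1 q) ⋆2 m,
rewrite every product of generators into a combination of the elements
(x ⋆1 p) ⋆2 q, where x is a generator and p and q are normal forms or 1.
Such normal forms are binary trees with labelled nodes (Leaf being 1, and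
Node x p q being (x ⋆1 p) ⋆2 q), which are counted by the Catalan numbers.

That no further relation is forced is seen on a model.  On the vector space
with the trees as a basis, the rewriting rules define two products by recursion
on the left factor ([tstar1_node], [tstar2_node]), and the relations are then
identities that follow by induction on the left factor ([tstar2A],
[tstar_compat], [tstar1A]).

The model is compared with a free algebra A in both directions.  The universal
property gives a morphism f from A to the model.  Conversely, the model maps
onto the unitization of A by evaluating trees, and the same rewriting rules,
now theorems in A, make this evaluation a morphism ([eval_morphism]).  Both
composites are the identity on monomials, so the normal monomials of degree k
are independent in A, since f maps them to distinct trees
([model_monomial]); they span the component of degree k because f respects the
degree and evaluation undoes f ([model_component]).  A basis of the component
is therefore indexed by the trees with k nodes labelled by a basis of V, of
which there are c_k (dim V)^k ([size_trees]). *)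

(** * Labelled binary trees and their number *)

Inductive tree (X : Type) := Leaf | Node of X & tree X & tree X.
Arguments Leaf {X}.

HB.instance Definition _ (X : Type) := gen_eqMixin (tree X).

Fixpoint nodes (X : Type) (t : tree X) : nat :=
  if t is Node _ p q then (nodes p + nodes q).+1 else 0.

Arguments nodes {X} t.

Section Counting.
Variable X : finType.
Implicit Types (x : X) (t : tree X) (f : seq (tree X)).

Definition graft x f : seq (tree X) :=
  if f is p :: q :: f' then Node x p q :: f' else [::].

(** Trees have no convenient recursion on the number of nodes, but ordered
forests do: deleting the first tree if it is a leaf, or its root if it is not,
turns [m.+1] trees with [n] nodes into [m] trees with [n] nodes or [m.+2] trees
with [n.-1] nodes. *)
Fixpoint forests (n : nat) : nat -> seq (seq (tree X)) :=
  fix forests_n (m : nat) :=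
    if m is m'.+1 then
      map (cons Leaf) (forests_n m')
      ++ (if n is n'.+1 then
            [seq graft x f | x <- enum X, f <- forests n' m'.+2]
          else [::])
    else if n is 0 then [:: [::]] else [::].

Lemma mem_forests n m f :
  (f \in forests n m) = (size f == m) && (sumn (map nodes f) == n).
Proof.
elim: n m f => [|n IHn]; elim=> [|m IHm] f.
- by case: f.
- have -> : forests 0 m.+1 = map (cons Leaf) (forests 0 m) by rewrite /= cats0.
  apply/mapP/idP => [[g]|].
    by rewrite IHm => Eg ->; rewrite /= eqSS add0n.
  case: f => [|[|x p q] f] Ef //; first by exists f; rewrite ?IHm.
  by move: Ef; rewrite andbC.
- by case: f => [|[|x p q] f].
have -> : forests n.+1 m.+1 = map (cons Leaf) (forests n.+1 m)
      ++ [seq graft x f | x <- enum X, f <- forests n m.+2] by [].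
rewrite mem_cat; apply/orP/idP => [[/mapP[g]|/allpairsP[[x g] /=]]|].
- by rewrite IHm => Eg ->.
- rewrite IHn => -[_ Eg ->].
  case: g Eg => [|p [|q g]] //= /andP[/eqP[->] /eqP <-].
  by rewrite eqxx /= addSn addnA.
case: f => [|[|x p q] f] //= Ef; [left|right].
  by rewrite mem_map ?IHm // => ? ? [].
apply/allpairsP; exists (x, p :: q :: f) => /=; rewrite mem_enum IHn /=.
by split=> //; rewrite addnA; exact: Ef.
Qed.

Lemma uniq_forests n m : uniq (forests n m).
Proof.
elim: n m => [|n IHn]; elim=> [|m IHm] //.
  by rewrite /= cats0 map_inj_uniq // => ? ? [].
have -> : forests n.+1 m.+1 = map (cons Leaf) (forests n.+1 m)
      ++ [seq graft x f | x <- enum X, f <- forests n m.+2] by [].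
rewrite cat_uniq map_inj_uniq ?IHm //=; last by move=> ? ? [].
have shape g : g \in forests n m.+2 -> exists p q h, g = p :: q :: h.
  by rewrite mem_forests; case: g => [|p [|q h]] // _; exists p, q, h.
apply/andP; split.
  apply/hasPn => _ /allpairsP[[x g] /= [_ /shape[p [q [h ->]]] ->]].
  by apply/mapP => -[].
apply: allpairs_uniq => //; first exact: enum_uniq.
move=> u v /allpairsP[[x g] [_ /shape[p [q [h ->]]] ->]].
move=> /allpairsP[[x' g'] [_ /shape[p' [q' [h' ->]]] ->]].
by rewrite /= => -[-> -> -> ->].
Qed.

(** The ballot numbers: the recursion of [forests] is Pascal's rule for both
binomial coefficients.  The subtracted one is written with the lower index
[n + m.+1] instead of the complementary [n - 1], which makes it vanish for
[n = 0]; it stands on the left because subtraction on [nat] is truncated. *)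
Lemma size_forests n m :
  size (forests n m.+1) + 'C(2 * n + m, n + m.+1) * #|X| ^ n
  = 'C(2 * n + m, n) * #|X| ^ n.
Proof.
elim: n m => [|n IHn] m.
  rewrite bin0 bin_small //.
  by elim: m => // m IHm; rewrite /= cats0 size_map -[RHS]IHm.
have sizeS k : size (forests n.+1 k.+1)
    = size (forests n.+1 k) + #|X| * size (forests n k.+2).
  by rewrite [forests n.+1 k.+1]/= size_cat size_map size_allpairs -cardE.
elim: m => [|m IHm]; rewrite sizeS.
  have -> : size (forests n.+1 0) = 0 by [].
  have := IHn 1; rewrite expnS.
  have -> : 2 * n.+1 + 0 = (2 * n + 1).+1 by lia.
  have -> : n.+1 + 1 = (n + 1).+1 by lia.
  rewrite !binS.
  have -> : n + 1 = n.+1 by lia.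
  have -> : n + 2 = n.+2 by lia.
  by move=> IH; nia.
have := IHn m.+2; rewrite expnS.
have -> : 2 * n.+1 + m.+1 = (2 * n + m.+2).+1 by lia.
have -> : n.+1 + m.+2 = (n + m.+2).+1 by lia.
rewrite !binS.
have -> : n + m.+3 = (n + m.+2).+1 by lia.
move=> IH; move: IHm; rewrite expnS.
have -> : 2 * n.+1 + m = 2 * n + m.+2 by lia.
have -> : n.+1 + m.+1 = n + m.+2 by lia.
nia.
Qed.

Definition trees k : seq (tree X) := map (head Leaf) (forests k 1).

Lemma mem_trees k t : (t \in trees k) = (nodes t == k).
Proof.
apply/mapP/eqP => [[f]|<-].
  by rewrite mem_forests; case: f => [|p []] //=; rewrite addn0 => /eqP <- ->.
by exists [:: t] => //; rewrite mem_forests /= addn0 !eqxx.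
Qed.

Lemma uniq_trees k : uniq (trees k).
Proof.
rewrite map_inj_in_uniq ?uniq_forests // => f g.
by rewrite !mem_forests; case: f => [|p []]; case: g => [|q []] // _ _ /= ->.
Qed.

Lemma size_trees k : size (trees k) = catalan k * #|X| ^ k.
Proof.
rewrite size_map; have := size_forests k 0.
rewrite addn0 addn1; set s := size _ => E.
have B : k.+1 * 'C(2 * k, k.+1) = k * 'C(2 * k, k).
  by rewrite mul_bin_left mul2n -addnn addnK.
apply/eqP; rewrite -(eqn_pmul2l (ltn0Sn k)); apply/eqP.
rewrite mulnA catalanE; apply/eqP.
rewrite -(eqn_add2r (k.+1 * ('C(2 * k, k.+1) * #|X| ^ k))) -mulnDr E.
by rewrite !mulnA B -mulnDl mulSn.
Qed.

End Counting.

Local Open Scope ring_scope.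

(** * Free modules *)

Section LinearExtension.
Variables (R : nzRingType) (K : choiceType) (M : lmodType R) (h : K -> M).

Definition lext (g : {malg R[K]}) : M := \sum_(k <- msupp g) g@_k *: h k.

Lemma lextEw (d : {fset K}) g :
  (msupp g `<=` d)%fset -> lext g = \sum_(k <- d) g@_k *: h k.
Proof.
move=> le; apply/big_fset_incl => // k _ /mcoeff_outdom ->.
by rewrite scale0r.
Qed.

Lemma lext_linear : linear lext.
Proof.
move=> c a b.
pose d := (msupp (c *: a + b) `|` (msupp a `|` msupp b))%fset.
rewrite (@lextEw d) ?fsubsetUl // (@lextEw d a); last first.
  by rewrite /d fsetUCA fsubsetUl.
rewrite (@lextEw d b); last by rewrite /d fsetUA fsubsetUr.
rewrite scaler_sumr -big_split; apply: eq_bigr => k _ /=.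
by rewrite mcoeffD mcoeffZ scalerDl scalerA.
Qed.

HB.instance Definition _ := GRing.isLinear.Build R {malg R[K]} M *:%R lext
  lext_linear.

Lemma lextU k : lext << k >> = h k.
Proof.
rewrite (@lextEw [fset k]%fset) ?msuppU_le //.
by rewrite big_seq_fset1 mcoeffUU scale1r.
Qed.

End LinearExtension.

(** A module with basis [K], presented by what a basis is good for: [fm_ext] and
[fm_extE] amount to independence of the [fm_gen k], and [fm_ind] to their
spanning the module. *)
Record free_module (R : nzRingType) (K : Type) := FreeModule {
  fm_sort : lmodType R;
  fm_gen : K -> fm_sort;
  fm_ext : forall M : lmodType R, (K -> M) -> {linear fm_sort -> M};
  fm_extE : forall (M : lmodType R) (h : K -> M) k, fm_ext h (fm_gen k) = h k;
  fm_ind : forall P : fm_sort -> Prop,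
    P 0 -> (forall c a b, P a -> P b -> P (c *: a + b)) ->
    (forall k, P (fm_gen k)) -> forall a, P a
}.

(** Opaque, so that linear combinations are only ever handled through the
interface above and never through their finitely supported coefficients. *)
Fact free_module_of (R : nzRingType) (K : Type) : free_module R K.
Proof.
pose U := {malg R[{classic K}]}; pose gen (k : {classic K}) : U := << k >>.
pose ext (M : lmodType R) (h : K -> M) : {linear U -> M} :=
  @lext R {classic K} M h.
exists U gen ext; first by move=> M h k; exact: lextU.
move=> P P0 PL PU a; rewrite [a]monalgE; elim/big_rec: _ => // k b _ Pb.
have -> : << a@_k *g k >> = a@_k *: gen k.
  by apply/malgP => k'; rewrite mcoeffZ !mcoeffU mulrnAr mulr1.
exact: PL.
Qed.

(** * Bilinear products *)

Section Bilinear.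
Variables (F : fieldType) (A : lmodType F) (s : A -> A -> A).
Hypothesis bs : bilinear_for *:%R *:%R s.

Lemma bilPl c k a b : s (k *: a + b) c = k *: s a c + s b c.
Proof. exact: bs.1. Qed.
Lemma bilPr c k a b : s c (k *: a + b) = k *: s c a + s c b.
Proof. exact: bs.2. Qed.
Lemma bilDl c a b : s (a + b) c = s a c + s b c.
Proof. by have := bilPl c 1 a b; rewrite !scale1r. Qed.
Lemma bilDr c a b : s c (a + b) = s c a + s c b.
Proof. by have := bilPr c 1 a b; rewrite !scale1r. Qed.
Lemma bil0l c : s 0 c = 0.
Proof. by apply: (addrI (s 0 c)); rewrite -bilDl !addr0. Qed.
Lemma bil0r c : s c 0 = 0.
Proof. by apply: (addrI (s c 0)); rewrite -bilDr !addr0. Qed.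
Lemma bilZl c k a : s (k *: a) c = k *: s a c.
Proof. by rewrite -[k *: a]addr0 bilPl bil0l addr0. Qed.
Lemma bilZr c k a : s c (k *: a) = k *: s c a.
Proof. by rewrite -[k *: a]addr0 bilPr bil0r addr0. Qed.
Lemma bilBl c a b : s (a - b) c = s a c - s b c.
Proof. by rewrite bilDl -scaleN1r bilZl scaleN1r. Qed.

End Bilinear.

Definition bil1 (F : fieldType) (A : as2AlgType F) :=
  let b := @star1_bilinear F A in
  (bilDl b, bilDr b, bilZl b, bilZr b, bil0l b, bil0r b).
Definition bil2 (F : fieldType) (A : as2AlgType F) :=
  let b := @star2_bilinear F A in
  (bilDl b, bilDr b, bilZl b, bilZr b, bil0l b, bil0r b).

Definition unital (F : fieldType) (B : as2AlgType F) (e : B) :=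
  [/\ left_id e star1, left_id e star2, right_id e star1 & right_id e star2].

Definition as2_linear (F : fieldType) (A B : as2AlgType F) (f : A -> B)
    (mf : as2_morphism f) : {linear A -> B} :=
  HB.pack f (GRing.isLinear.Build F A B *:%R f (let: And3 lf _ _ := mf in lf)).

(** * The model on binary trees *)

Section TreeAlgebra.
Variables (F : fieldType) (X : Type).

Definition treealg : Type := fm_sort (free_module_of F (tree X)).
HB.instance Definition _ := GRing.Lmodule.copy treealg
  (fm_sort (free_module_of F (tree X))).

Definition tree1 (t : tree X) : treealg := fm_gen (free_module_of F (tree X)) t.
Local Notation "1t" := (tree1 Leaf).

Definition ext (M : lmodType F) (h : tree X -> M) : treealg -> M :=
  fm_ext (free_module_of F (tree X)) h.

Lemma extE (M : lmodType F) (h : tree X -> M) t : ext h (tree1 t) = h t.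
Proof. exact: fm_extE. Qed.

Fact ext_linear (M : lmodType F) (h : tree X -> M) : linear (ext h).
Proof. by move=> c a b; rewrite /ext linearP. Qed.

HB.instance Definition _ (M : lmodType F) (h : tree X -> M) :=
  GRing.isLinear.Build F treealg M *:%R (ext h) (ext_linear h).

Lemma treealg_ind (P : treealg -> Prop) :
  (forall k a b, P a -> P b -> P (k *: a + b)) ->
  (forall t, P (tree1 t)) -> forall a, P a.
Proof.
move=> PL P1; apply: fm_ind => //.
by rewrite -(addNr 1t) -scaleN1r; exact: PL.
Qed.

Implicit Types (x : X) (p q t : tree X) (a b c m : treealg).

Definition node x a b : treealg :=
  ext (fun p => ext (fun q => tree1 (Node x p q)) b) a.

(** Left multiplication by a tree.  Reading [Node x p q] as (x ⋆1 p) ⋆2 q,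
[act2] is associativity of ⋆2.  For [act1], compatibility of x ⋆1 p, q and m
gives (x ⋆1 p) ⋆1 (q ⋆2 m) + (x ⋆1 p) ⋆2 (q ⋆1 m) - ((x ⋆1 p) ⋆1 q) ⋆2 m, and
associativity of ⋆1 moves x to the left in the first and the last term.  Since
[Leaf] is a unit for both products, no case distinction on [p] and [q] is
needed. *)
Fixpoint act2 t m : treealg :=
  if t is Node x p q then node x (tree1 p) (act2 q m) else m.

Fixpoint act1 t m : treealg :=
  if t is Node x p q then
    node x (act1 p (act2 q m)) 1t + node x (tree1 p) (act1 q m)
    - node x (act1 p (tree1 q)) m
  else m.

Definition tstar1 a b : treealg := ext (act1^~ b) a.
Definition tstar2 a b : treealg := ext (act2^~ b) a.

Lemma node_tree x p q : node x (tree1 p) (tree1 q) = tree1 (Node x p q).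
Proof. by rewrite /node !extE. Qed.

Lemma extr_linear (h : tree X -> treealg -> treealg) a :
  (forall t, linear (h t)) -> linear (fun b => ext (h^~ b) a).
Proof.
move=> lh k b c /=; elim/treealg_ind: a => [l a a' IH IH'|t].
  have E u : ext (h^~ u) (l *: a + a') = l *: ext (h^~ u) a + ext (h^~ u) a'.
    exact: linearP.
  by rewrite !E IH IH' !scalerDr addrACA !scalerA mulrC.
by rewrite !extE lh.
Qed.

Lemma node_bilinear x : bilinear_for *:%R *:%R (node x).
Proof.
split=> m; first by move=> k a b; rewrite /= /node linearP.
apply: (extr_linear (h := fun p => ext (fun q => tree1 (Node x p q)))).
by move=> p; exact: linearP.
Qed.

Let nodePl x := bilPl (node_bilinear x).
Let nodePr x := bilPr (node_bilinear x).

Lemma lincombB k a a' b b' c c' :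
  (k *: a + a') + (k *: b + b') - (k *: c + c')
  = k *: (a + b - c) + (a' + b' - c').
Proof. by rewrite addrACA -scalerDr opprD addrACA -scalerBr. Qed.

Lemma act2_linear t : linear (act2 t).
Proof. by elim: t => //= x p _ q IH k a b; rewrite IH nodePr. Qed.

Lemma act1_linear t : linear (act1 t).
Proof.
elim: t => //= x p IHp q IHq k a b.
by rewrite act2_linear IHp IHq nodePl !nodePr lincombB.
Qed.

Fact tstar1_bilinear : bilinear_for *:%R *:%R tstar1.
Proof.
split=> m; last exact/extr_linear/act1_linear.
by move=> k a b; rewrite /= /tstar1 linearP.
Qed.

Fact tstar2_bilinear : bilinear_for *:%R *:%R tstar2.
Proof.
split=> m; last exact/extr_linear/act2_linear.
by move=> k a b; rewrite /= /tstar2 linearP.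
Qed.

Let tstar1Pl := bilPl tstar1_bilinear.
Let tstar1Pr := bilPr tstar1_bilinear.
Let tstar2Pl := bilPl tstar2_bilinear.

Lemma treealg_node_ind (P : treealg -> Prop) :
  (forall k a b, P a -> P b -> P (k *: a + b)) ->
  P 1t ->
  (forall x a b, P a -> P b -> P (node x a b)) ->
  forall a, P a.
Proof.
move=> PL P1 PN; apply: treealg_ind => //; elim=> // x p Pp q Pq.
by rewrite -node_tree; exact: PN.
Qed.

Lemma tstar1_leaf m : tstar1 1t m = m.
Proof. by rewrite /tstar1 extE. Qed.
Lemma tstar2_leaf m : tstar2 1t m = m.
Proof. by rewrite /tstar2 extE. Qed.

Lemma tstar2_node x a b m : tstar2 (node x a b) m = node x a (tstar2 b m).
Proof.
elim/treealg_ind: a => [k a a' IH IH'|p].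
  by rewrite !(nodePl, tstar2Pl) IH IH'.
elim/treealg_ind: b => [k b b' IH IH'|q].
  by rewrite !(nodePr, tstar2Pl) IH IH'.
by rewrite node_tree /tstar2 !extE.
Qed.

Lemma tstar1_node x a b m :
  tstar1 (node x a b) m
  = node x (tstar1 a (tstar2 b m)) 1t + node x a (tstar1 b m)
    - node x (tstar1 a b) m.
Proof.
elim/treealg_ind: a => [k a a' IH IH'|p].
  by rewrite !(nodePl, tstar1Pl) IH IH' lincombB.
elim/treealg_ind: b => [k b b' IH IH'|q].
  by rewrite !(nodePr, nodePl, tstar1Pl, tstar2Pl, tstar1Pr) IH IH' lincombB.
by rewrite node_tree /tstar1 /tstar2 !extE.
Qed.

Lemma tstar2_leafr m : tstar2 m 1t = m.
Proof.
elim/treealg_node_ind: m => [k a b IH IH'||x p q _ IH].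
- by rewrite tstar2Pl IH IH'.
- exact: tstar2_leaf.
- by rewrite tstar2_node IH.
Qed.

Lemma tstar1_leafr m : tstar1 m 1t = m.
Proof.
elim/treealg_node_ind: m => [k a b IH IH'||x p q _ IH].
- by rewrite tstar1Pl IH IH'.
- exact: tstar1_leaf.
- by rewrite tstar1_node tstar2_leafr IH addrAC subrr add0r.
Qed.

Lemma tstar1_node_leaf x a m :
  tstar1 (node x a 1t) m = node x (tstar1 a m) 1t.
Proof. by rewrite tstar1_node tstar2_leaf tstar1_leaf tstar1_leafr addrK. Qed.

Lemma tstar2A a b c : tstar2 (tstar2 a b) c = tstar2 a (tstar2 b c).
Proof.
elim/treealg_node_ind: a => [k a a' IH IH'||x p q _ IH].
- by rewrite !tstar2Pl IH IH'.
- by rewrite !tstar2_leaf.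
- by rewrite !tstar2_node IH.
Qed.

(** Induction on [a]; at a node, both sides expand by the defining rules and
differ only by the relation for the right subtree, placed under the node. *)
Lemma tstar_compat a b c :
  tstar2 (tstar1 a b) c + tstar1 (tstar2 a b) c
  = tstar1 a (tstar2 b c) + tstar2 a (tstar1 b c).
Proof.
elim/treealg_node_ind: a => [k a a' IH IH'||x p q _ IH].
- by rewrite !(tstar1Pl, tstar2Pl) addrACA -scalerDr IH IH' scalerDr addrACA.
- by rewrite !(tstar1_leaf, tstar2_leaf) addrC.
rewrite tstar2_node !tstar1_node.
rewrite (bilBl tstar2_bilinear) (bilDl tstar2_bilinear) !tstar2_node.
rewrite tstar2_leaf tstar2A.
have := congr1 (node x p) IH; rewrite !(bilDr (node_bilinear x)) => {}IH.
(* Both sides are the same two terms plus the two sides of [IH]; on the left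
   the terms node x (p ⋆1 (q ⋆2 b)) c cancel. *)
rewrite [RHS](AC (3*1) ((1*3)*(2*4))) /= -IH.
by rewrite [LHS](AC (3*3) ((1*6)*((4*3)*(2*5)))) /= subrr add0r.
Qed.

(** Induction on [a]; at a node with subtrees [p] and [q], associativity for [p]
and for [q] leaves exactly the compatibility of [q], [b] and [c], multiplied
by [p] and placed under the node. *)
Lemma tstar1A a b c : tstar1 (tstar1 a b) c = tstar1 a (tstar1 b c).
Proof.
elim/treealg_node_ind: a b c => [k a a' IH IH' b c|b c|x p q IHp IHq b c].
- by rewrite !tstar1Pl IH IH'.
- by rewrite !tstar1_leaf.
rewrite [tstar1 (node x p q) b]tstar1_node (bilBl tstar1_bilinear).
rewrite (bilDl tstar1_bilinear) tstar1_node_leaf.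
rewrite !tstar1_node !IHp !IHq.
have := congr1 (fun m => node x (tstar1 p m) 1t) (tstar_compat q b c).
rewrite !(bilDr tstar1_bilinear) !(bilDl (node_bilinear x)) => E.
rewrite !opprD !opprK.
(* The terms node x (p ⋆1 (q ⋆1 b)) c cancel, and so does, after [E], the term
   with q ⋆1 (b ⋆2 c). *)
by rewrite [LHS](AC ((1*3)*3) ((5*(2*1)*3*6)*(7*4))) /= subrr addr0 E addKr.
Qed.

HB.instance Definition _ := Lmodule_isAs2Algebra.Build F treealg
  tstar1_bilinear tstar2_bilinear tstar1A tstar2A tstar_compat.

Lemma leaf_unital : unital (1t : treealg).
Proof.
split=> a; [exact: tstar1_leaf | exact: tstar2_leaf | exact: tstar1_leafr
           | exact: tstar2_leafr].
Qed.

End TreeAlgebra.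
Arguments node_bilinear {F X} x.
Arguments tstar1_bilinear {F X}.
Arguments tstar2_bilinear {F X}.

(** * Unitization *)

Section UnitalProduct.
Variables (F : fieldType) (A : lmodType F).

(** The product on pairs (k, a), read as k 1 + a, that
extends [s] by a unit 1. *)
Definition unit_ext (s : A -> A -> A) (u v : F^o * A) : F^o * A :=
  (u.1 * v.1, u.1 *: v.2 + v.1 *: u.2 + s u.2 v.2).

Lemma unit_ext_bilinear (s : A -> A -> A) :
  bilinear_for *:%R *:%R s -> bilinear_for *:%R *:%R (unit_ext s).
Proof.
move=> bs; split=> -[m c] k [l a] [n b]; rewrite /unit_ext /=; congr pair => /=.
- by rewrite mulrDl -mulrA.
- rewrite (bilPl bs) scalerDl !scalerDr !scalerA [k * m]mulrC addrACA.
  by rewrite -[k *: l]/(k * l) (AC (3*3) ((1*4*3)*(2*5*6))).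
- by rewrite mulrDr -[k *: l]/(k * l) mulrCA.
- rewrite (bilPr bs) scalerDl !scalerDr !scalerA [k * m]mulrC addrACA.
  by rewrite -[k *: l]/(k * l) (AC (3*3) ((1*4*3)*(2*5*6))).
Qed.

(** The iterated products below mix two bilinear maps, so that one computation
serves associativity ([s = t]) and compatibility ([s] and [t] exchanged). *)
Section TwoProducts.
Variables s t : A -> A -> A.
Hypotheses (bs : bilinear_for *:%R *:%R s) (bt : bilinear_for *:%R *:%R t).

Lemma unit_ext_left u v w :
  unit_ext t (unit_ext s u v) w
  = (u.1 * v.1 * w.1,
     (u.1 * v.1) *: w.2 + (u.1 * w.1) *: v.2 + (v.1 * w.1) *: u.2
     + (w.1 *: s u.2 v.2 + u.1 *: t v.2 w.2 + v.1 *: t u.2 w.2)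
     + t (s u.2 v.2) w.2).
Proof.
rewrite /unit_ext /=; congr pair.
rewrite !(bilDl bt) !(bilZl bt) !scalerDr !scalerA !addrA.
by rewrite [w.1 * u.1]mulrC [w.1 * v.1]mulrC.
Qed.

Lemma unit_ext_right u v w :
  unit_ext s u (unit_ext t v w)
  = (u.1 * v.1 * w.1,
     (u.1 * v.1) *: w.2 + (u.1 * w.1) *: v.2 + (v.1 * w.1) *: u.2
     + (w.1 *: s u.2 v.2 + u.1 *: t v.2 w.2 + v.1 *: s u.2 w.2)
     + s u.2 (t v.2 w.2)).
Proof.
rewrite /unit_ext /= mulrA; congr pair.
rewrite !(bilDr bs) !(bilZr bs) !scalerDr !scalerA !addrA.
by rewrite [LHS](ACl (1*2*4*6*3*5*7)).
Qed.
End TwoProducts.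

Lemma unit_extA (s : A -> A -> A) u v w : bilinear_for *:%R *:%R s ->
  (forall a b c, s (s a b) c = s a (s b c)) ->
  unit_ext s (unit_ext s u v) w = unit_ext s u (unit_ext s v w).
Proof. by move=> bs sA; rewrite unit_ext_left // unit_ext_right // sA. Qed.

End UnitalProduct.

Section Unitization.
Variables (F : fieldType) (A : as2AlgType F).

(** The same unit is adjoined for both products: both relations hold as soon as
one of the three factors is a common unit. *)
Definition unitization : Type := (F^o * A)%type.
HB.instance Definition _ := GRing.Lmodule.on unitization.

Definition ustar1 : unitization -> unitization -> unitization :=
  unit_ext (@star1 F A).
Definition ustar2 : unitization -> unitization -> unitization :=
  unit_ext (@star2 F A).

Fact ustar1A u v w : ustar1 (ustar1 u v) w = ustar1 u (ustar1 v w).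
Proof. exact: unit_extA star1_bilinear (@star1A F A). Qed.

Fact ustar2A u v w : ustar2 (ustar2 u v) w = ustar2 u (ustar2 v w).
Proof. exact: unit_extA star2_bilinear (@star2A F A). Qed.

Fact ustar_compat u v w :
  ustar2 (ustar1 u v) w + ustar1 (ustar2 u v) w
  = ustar1 u (ustar2 v w) + ustar2 u (ustar1 v w).
Proof.
have [b1 b2] := (@star1_bilinear F A, @star2_bilinear F A).
rewrite /ustar1 /ustar2 !unit_ext_left // !unit_ext_right //.
apply: injective_projections => //=.
rewrite (AC (3*3) ((1*4)*(2*5)*(3*6))) /= star_compat.
rewrite [RHS](AC (3*3) ((1*4)*(2*5)*(3*6))) /=; congr (_ + _ + _).
by rewrite (AC (3*3) ((1*2*6)*(4*5*3))).
Qed.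

HB.instance Definition _ := Lmodule_isAs2Algebra.Build F unitization
  (unit_ext_bilinear star1_bilinear) (unit_ext_bilinear star2_bilinear)
  ustar1A ustar2A ustar_compat.

Definition uone : unitization := (1, 0).
Definition uinc (a : A) : unitization := (0, a).

Fact uinc_linear : linear uinc.
Proof. by move=> k a b; congr pair; rewrite /= scaler0 addr0. Qed.

HB.instance Definition _ := GRing.isLinear.Build F A unitization *:%R uinc
  uinc_linear.

Lemma uinc1 a b : uinc (a ⋆1 b) = uinc a ⋆1 uinc b.
Proof. by congr pair; rewrite /= ?mul0r // !scale0r !add0r. Qed.

Lemma uinc2 a b : uinc (a ⋆2 b) = uinc a ⋆2 uinc b.
Proof. by congr pair; rewrite /= ?mul0r // !scale0r !add0r. Qed.

Lemma uone_unital : unital uone.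
Proof.
split=> -[k a]; congr pair; rewrite /= ?mul1r ?mulr1 // scaler0 scale1r.
- by rewrite !bil1 !addr0.
- by rewrite !bil2 !addr0.
- by rewrite !bil1 add0r addr0.
- by rewrite !bil2 add0r addr0.
Qed.

Section UnitalExtension.
Variables (B : as2AlgType F) (e : B) (f : A -> B).
Hypotheses (ue : unital e) (mf : as2_morphism f).

Definition uext (u : unitization) : B := (u.1 : F) *: e + f u.2.

Lemma uext_morphism : as2_morphism uext.
Proof.
case: ue mf => l1 l2 r1 r2 [lf f1 f2].
have fD : {morph f : a b / a + b} := linearD (as2_linear mf).
have fZ k : {morph f : a / k *: a} := linearZ_LR (as2_linear mf) k.
split=> [k [m a] [n b]|[m a] [n b]|[m a] [n b]]; rewrite /uext /=.
- by rewrite lf scalerDl scalerDr scalerA addrACA.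
- by rewrite !fD !fZ f1 !bil1 l1 l1 r1 scalerA -!addrA; do !congr (_ + _).
- by rewrite !fD !fZ f2 !bil2 l2 l2 r2 scalerA -!addrA; do !congr (_ + _).
Qed.

End UnitalExtension.
End Unitization.

(** * Evaluation of trees *)

Section Evaluation.
Variables (F : fieldType) (X : Type).
Variables (B : as2AlgType F) (e : B) (g : X -> B).
Hypothesis ue : unital e.

Fixpoint eval_tree t : B :=
  if t is Node x p q then (g x ⋆1 eval_tree p) ⋆2 eval_tree q else e.

Definition eval : treealg F X -> B := ext eval_tree.

Lemma eval_tree1 t : eval (tree1 F t) = eval_tree t. Proof. exact: extE. Qed.

Lemma eval_linear : linear eval. Proof. exact: linearP. Qed.

HB.instance Definition _ := GRing.isLinear.Build F (treealg F X) B *:%R eval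
  eval_linear.

Lemma eval_node x a b : eval (node x a b) = (g x ⋆1 eval a) ⋆2 eval b.
Proof.
elim/treealg_ind: a => [k a a' IH IH'|p].
  rewrite (bilPl (node_bilinear x)) !eval_linear IH IH'.
  by rewrite (bilPr star1_bilinear) (bilPl star2_bilinear).
elim/treealg_ind: b => [k b b' IH IH'|q].
  rewrite (bilPr (node_bilinear x)) !eval_linear IH IH'.
  by rewrite (bilPr star2_bilinear).
by rewrite node_tree !eval_tree1.
Qed.

(** The rules defining the products of the model hold in [B] for the values of
trees, so evaluation respects both products, by induction on the left factor. *)
Lemma eval_morphism : as2_morphism eval.
Proof.
case: ue => l1 l2 r1 r2.
have m2 : {morph eval : a b / tstar2 a b >-> a ⋆2 b}.
  move=> a b; elim/treealg_node_ind: a => [k a a' IH IH'||x p q _ IH].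
  - by rewrite (bilPl tstar2_bilinear) !eval_linear IH IH'
      (bilPl star2_bilinear).
  - by rewrite tstar2_leaf eval_tree1 /= l2.
  - by rewrite tstar2_node !eval_node IH star2A.
split; [exact: eval_linear| |exact: m2].
suff m1 : {morph eval : a b / tstar1 a b >-> a ⋆1 b} by exact: m1.
move=> a b; elim/treealg_node_ind: a b => [k a a' IH IH'|b|x p q IHp IHq b].
- by move=> b; rewrite (bilPl tstar1_bilinear) !eval_linear IH IH'
      (bilPl star1_bilinear).
- by rewrite tstar1_leaf eval_tree1 /= l1.
rewrite tstar1_node linearB linearD /= !eval_node !IHp !IHq m2 eval_tree1 /= r2.
rewrite -!star1A -star_compat.
by rewrite addrAC addrN add0r.
Qed.

End Evaluation.

(** * Linear spans *)

Section LinSpan.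
Variables (F : fieldType) (A : lmodType F).
Implicit Types S T : A -> Prop.

Lemma lin_span_gen S x : S x -> lin_span S x.
Proof.
move=> Sx; exists 1, (fun=> 1), (fun=> x); split=> //.
by rewrite big_ord1 scale1r.
Qed.

Lemma lin_span0 S : lin_span S 0.
Proof.
by exists 0, (fun=> 0), (fun=> 0); split=> [[]|] //; rewrite big_ord0.
Qed.

Lemma lin_spanP S k x y :
  lin_span S x -> lin_span S y -> lin_span S (k *: x + y).
Proof.
move=> [m [c [s [Ss ->]]]] [n [c' [s' [Ss' ->]]]].
exists (m + n)%N,
  (fun j => match split j with inl j1 => k * c j1 | inr j2 => c' j2 end),
  (fun j => match split j with inl j1 => s j1 | inr j2 => s' j2 end); split.
  by move=> j; case: (split j).
rewrite big_split_ord scaler_sumr; congr (_ + _); apply: eq_bigr => j _.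
  by rewrite (unsplitK (inl _ j)) scalerA.
by rewrite (unsplitK (inr _ j)).
Qed.

Lemma lin_span_ind S (P : A -> Prop) :
  P 0 -> (forall k x y, P x -> P y -> P (k *: x + y)) ->
  (forall x, S x -> P x) -> forall x, lin_span S x -> P x.
Proof.
move=> P0 PL PS x [n [c [s [Ss ->]]]].
by elim/big_rec: _ => // j y _; apply: PL; exact: PS.
Qed.

Lemma lin_span_family n (b : 'I_n -> A) x :
  lin_span (fun y => exists j, y = b j) x <->
  exists c : 'I_n -> F, x = \sum_j c j *: b j.
Proof.
split=> [|[c ->]]; last by exists n, c, b; split=> // j; exists j.
move: x; apply: lin_span_ind => [|k x y [c ->] [c' ->]|_ [j ->]].
- by exists (fun=> 0); rewrite big1 // => j _; rewrite scale0r.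
- exists (fun j => k * c j + c' j); rewrite scaler_sumr -big_split.
  by apply: eq_bigr => j _; rewrite scalerDl scalerA.
- exists (fun j' => (j' == j)%:R); rewrite (bigD1 j) //= eqxx scale1r.
  by rewrite big1 ?addr0 // => j' /negPf ->; rewrite scale0r.
Qed.

End LinSpan.

Lemma lin_span_bil (F : fieldType) (A : lmodType F) (s : A -> A -> A)
    (S T U : A -> Prop) :
  bilinear_for *:%R *:%R s ->
  (forall a b, S a -> T b -> lin_span U (s a b)) ->
  forall a b, lin_span S a -> lin_span T b -> lin_span U (s a b).
Proof.
move=> bs H a b Sa Tb; elim/lin_span_ind: Sa => {a} [|k a a' IH IH'|a Sa].
- by rewrite (bil0l bs); exact: lin_span0.
- by rewrite (bilPl bs); exact: lin_spanP.
elim/lin_span_ind: Tb => {b} [|k b b' IH IH'|b Tb]; last exact: H.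
- by rewrite (bil0r bs); exact: lin_span0.
- by rewrite (bilPr bs); exact: lin_spanP.
Qed.

(** * The degree on the model *)

Section Degree.
Variables (F : fieldType) (X : Type).
Implicit Types (a b : treealg F X).

Definition homog k : treealg F X -> Prop :=
  lin_span (fun a => exists2 t, nodes t = k & a = tree1 F t).

Lemma homog_tree t : homog (nodes t) (tree1 F t).
Proof. by apply: lin_span_gen; exists t. Qed.

Lemma homog_node m n x a b :
  homog m a -> homog n b -> homog (m + n).+1 (node x a b).
Proof.
apply: lin_span_bil => [|_ _ [p <- ->] [q <- ->]].
  exact: node_bilinear.
by rewrite node_tree; exact: (homog_tree (Node x p q)).
Qed.

Lemma homog_star2 m n a b : homog m a -> homog n b -> homog (m + n) (a ⋆2 b).
Proof.
move=> Ha Hb; elim/lin_span_ind: Ha => {a} [|k a a' IH IH'|_ [t <- ->]].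
- by rewrite (bil0l star2_bilinear); exact: lin_span0.
- by rewrite (bilPl star2_bilinear); exact: lin_spanP.
suff: homog (nodes t + n) (tstar2 (tree1 F t) b) by [].
elim: t => [|x p _ q IH]; first by rewrite tstar2_leaf.
rewrite -node_tree tstar2_node /= addSn -addnA.
by apply: homog_node => //; exact: homog_tree.
Qed.

Lemma homogB m a b : homog m a -> homog m b -> homog m (a - b).
Proof. by move=> Ha Hb; rewrite addrC -scaleN1r; exact: lin_spanP. Qed.

Lemma homogD m a b : homog m a -> homog m b -> homog m (a + b).
Proof. by move=> Ha Hb; rewrite -[a]scale1r; exact: lin_spanP. Qed.

Lemma homog_star1 m n a b : homog m a -> homog n b -> homog (m + n) (a ⋆1 b).
Proof.
apply: lin_span_bil; first exact: star1_bilinear.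
move=> {}a {}b [t <- ->] [t' <- ->]; have := homog_tree t'.
move: (nodes t') (tree1 F t') => {}n {t'}b Hb.
suff: homog (nodes t + n) (tstar1 (tree1 F t) b) by [].
elim: t n b Hb => [|x p IHp q IHq] n b Hb; first by rewrite tstar1_leaf.
have Hp := homog_tree p; have Hq := homog_tree q.
rewrite -node_tree tstar1_node /= addSn -addnA.
apply: homogB; first apply: homogD.
(* The right subtree is [Leaf], of degree 0. *)
- by rewrite -[(_ + (_ + _))%N]addn0; apply: homog_node (homog_tree Leaf);
  apply: IHp; exact: homog_star2.
- by apply: homog_node => //; exact: IHq.
- by rewrite addnA; apply: homog_node => //; exact: IHp.
Qed.

End Degree.

(** * Comparison of a free algebra with the model *)

Section FreeAlgebra.
Variables (F : fieldType) (V : vectType F) (A : as2AlgType F).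
Variable i : {linear V -> A}.
Local Notation d := (\dim {:V}).
Local Notation e := (vbasis {:V}).
Local Notation U := (treealg F 'I_d).

Definition letter (j : 'I_d) : U := tree1 F (Node j Leaf Leaf).

Definition letter_ext (v : V) : U := \sum_j coord e j v *: letter j.

Fact letter_ext_linear : linear letter_ext.
Proof.
move=> k u v; rewrite /letter_ext scaler_sumr -big_split.
by apply: eq_bigr => j _; rewrite linearP scalerDl scalerA.
Qed.

HB.instance Definition _ := GRing.isLinear.Build F V U *:%R letter_ext
  letter_ext_linear.

Lemma letter_ext_basis (j : 'I_d) : letter_ext e`_j = letter j.
Proof.
have fe : free e := basis_free (vbasisP _).
rewrite /letter_ext (bigD1 j) //= coord_free // eqxx scale1r.
rewrite big1 ?addr0 // => j' /negPf nj.
by rewrite coord_free // eq_sym nj scale0r.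
Qed.

Lemma letter_stars (j : 'I_d) p q :
  (letter j ⋆1 tree1 F p) ⋆2 tree1 F q = tree1 F (Node j p q).
Proof.
suff: tstar2 (tstar1 (letter j) (tree1 F p)) (tree1 F q)
  = tree1 F (Node j p q) by [].
rewrite /letter -node_tree tstar1_node_leaf tstar1_leaf tstar2_node tstar2_leaf.
exact: node_tree.
Qed.

Definition gens (j : 'I_d) : unitization A := uinc (i e`_j).

Definition value : tree 'I_d -> unitization A := eval_tree (uone A) gens.

Lemma valueE j p q : value (Node j p q) = (gens j ⋆1 value p) ⋆2 value q.
Proof. by []. Qed.

Lemma value_product t :
  (t = Leaf /\ value t = uone A) \/
  exists2 a, value t = uinc a & as2_product i (nodes t) a.
Proof.
have [l1 l2 r1 r2] := uone_unital A.
elim: t => [|j p IHp q IHq]; [by left|right].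
rewrite valueE /=; have [a -> Pa] : exists2 a, gens j ⋆1 value p = uinc a &
    as2_product i (nodes p).+1 a.
  case: IHp => [[-> ->]|[a -> Pa]].
    by rewrite r1; exists (i e`_j) => //; exact: Product_gen.
  exists (i e`_j ⋆1 a); first by rewrite -uinc1.
  by apply: (Product_star1 (m := 1)) Pa; exact: Product_gen.
case: IHq => [[-> Eq]|[b Eb Pb]].
  by exists a; rewrite ?addn0 // Eq r2.
exists (a ⋆2 b); first by rewrite Eb uinc2.
by rewrite -addSn; exact: Product_star2.
Qed.

(** The second component of the unitization is [A]; [monomial Leaf] is the junk
value 0, as 1 is not in [A]. *)
Definition monomial t : A := (value t).2.

Lemma value_monomial k t : (0 < k)%N -> nodes t = k ->
  value t = uinc (monomial t) /\ as2_product i k (monomial t).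
Proof.
move=> k0 nt; rewrite -{}nt in k0 *; rewrite /monomial.
by case: (value_product t) k0 => [[-> //]|[a -> Pa]].
Qed.

Section ComparisonWithModel.
Variable f : A -> U.
Hypotheses (mf : as2_morphism f) (fi : forall v, f (i v) = letter_ext v).

(** The extension of [f] to the unitization inverts evaluation on trees, because
in the model every tree is the value of its own expression. *)
Lemma uext_value t : uext (tree1 F Leaf) f (value t) = tree1 F t.
Proof.
have [_ m1 m2] := uext_morphism (leaf_unital F 'I_d) mf.
have f0 : f 0 = 0 := linear0 (as2_linear mf).
elim: t => [|j p IHp q IHq]; first by rewrite /uext /= scale1r f0 addr0.
rewrite valueE m2 m1 IHp IHq /uext /= scale0r add0r.
by rewrite fi letter_ext_basis letter_stars.
Qed.

Lemma model_monomial k t :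
  (0 < k)%N -> nodes t = k -> f (monomial t) = tree1 F t.
Proof.
move=> k0 nt; have [Et _] := value_monomial k0 nt.
by rewrite -[RHS]uext_value Et /uext /= scale0r add0r.
Qed.

(** Both properties are inherited by products, so checking them on generators
suffices; together they express [x] by trees with [k] nodes. *)
Lemma model_product k x : as2_product i k x ->
  homog k (f x) /\ eval (uone A) gens (f x) = uinc x.
Proof.
have [_ f1 f2] := mf; have [l1 l2 r1 r2] := uone_unital A.
have [_ p1 p2] := eval_morphism gens (uone_unital A).
elim=> {k x} [v|m n a b _ [Ha Ea] _ [Hb Eb]|m n a b _ [Ha Ea] _ [Hb Eb]].
- rewrite fi; split.
    rewrite /letter_ext; elim/big_rec: _ => [|j a _]; first exact: lin_span0.
    by apply: lin_spanP; exact: (homog_tree _ (Node j Leaf Leaf)).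
  rewrite /letter_ext linear_sum [in RHS](coord_vbasis (memvf v)) !linear_sum.
  apply: eq_bigr => j _; rewrite !linearZ; congr (_ *: _).
  by rewrite /= eval_tree1 /= r2 r1.
- rewrite f1 p1 Ea Eb uinc1; split=> //; exact: homog_star1.
- rewrite f2 p2 Ea Eb uinc2; split=> //; exact: homog_star2.
Qed.

Lemma model_component k x : graded_component i k x ->
  homog k (f x) /\ eval (uone A) gens (f x) = uinc x.
Proof.
have [lf _ _] := mf; have f0 : f 0 = 0 := linear0 (as2_linear mf).
elim/lin_span_ind => [|c a b [Ha Ea] [Hb Eb]|a]; last exact: model_product.
  by rewrite f0 !linear0; split=> //; exact: lin_span0.
by rewrite lf !linearP /= Ea Eb; split=> //; exact: lin_spanP.
Qed.

Lemma component_dim k : (0 < k)%N ->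
  has_dim (graded_component i k) (size (trees 'I_d k)).
Proof.
move=> k0; set ts := trees 'I_d k.
pose b (j : 'I_(size ts)) := monomial (nth Leaf ts j).
have nt (j : 'I_(size ts)) : nodes (nth Leaf ts j) = k.
  by apply/eqP; rewrite -mem_trees mem_nth.
exists b; split=> [c Ec j|x].
  pose fl := as2_linear mf.
  have : \sum_j c j *: tree1 F (nth Leaf ts j) = 0 :> U.
    rewrite -[RHS](linear0 fl) -[in RHS]Ec linear_sum; apply: eq_bigr => j' _.
    by rewrite linearZ /= (model_monomial k0 (nt _)).
  (* The linear form that extends this indicator reads off the coefficient. *)
  move/(congr1 (ext (fun t => (t == nth Leaf ts j)%:R : F^o))).
  rewrite linear0 linear_sum (bigD1 j) //= big1 => [|j' nj];
    rewrite linearZ /= extE.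
    by rewrite eqxx addr0 => <-; rewrite /GRing.scale /= mulr1.
  rewrite nth_uniq ?uniq_trees // -[_ == _ :> nat]/(j' == j).
  by rewrite (negPf nj) scaler0.
rewrite -lin_span_family; split=> [/model_component[Hx Ex]|].
  have -> : x = (eval (uone A) gens (f x)).2 by rewrite Ex.
  elim/lin_span_ind: Hx => [|c u v IHu IHv|_ [t tk ->]].
  - by rewrite linear0; exact: lin_span0.
  - by rewrite linearP; exact: lin_spanP.
  rewrite eval_tree1; apply: lin_span_gen.
  have tts : (index t ts < size ts)%N by rewrite index_mem mem_trees tk.
  by exists (Ordinal tts); rewrite /b /= nth_index // -index_mem.
elim/lin_span_ind => [|c u v IHu IHv|_ [j ->]].
- exact: lin_span0.
- exact: lin_spanP.
by apply: lin_span_gen; case: (value_monomial k0 (nt j)).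
Qed.

End ComparisonWithModel.
End FreeAlgebra.

Theorem corollary2 (F : fieldType) (charF0 : [pchar F] =i pred0)
    (V : vectType F) (A : as2AlgType F) (i : {linear V -> A})
    (freeA : is_free_as2 i) :
  (forall k : nat, (1 <= k)%N ->
     has_dim (graded_component i k) (catalan k * (\dim {:V}) ^ k)%N) /\
  (\dim {:V} = 1%N ->
     forall k : nat, (1 <= k)%N -> has_dim (graded_component i k) (catalan k)).
Proof.
have dimk k : (1 <= k)%N ->
    has_dim (graded_component i k) (catalan k * (\dim {:V}) ^ k)%N.
  move=> k0; have [[f mf fi] _] := freeA _ (@letter_ext F V).
  by have := component_dim mf fi k0; rewrite size_trees card_ord.
split=> // d1 k k0; have := dimk k k0.
by rewrite d1 exp1n muln1.
Qed.
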